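(* For every $n\in\mathbb{N}$, there is a triangulation of $n$ points in the plane that contains $O(n^{2\log 3}\log^2 n)=O(n^{3.17})$ monotone paths.
   Context: Logarithms are base 2. A triangulation of a point set is a maximal plane straight-line graph on it. A path $(w_1,\dots,w_t)$ is monotone in direction $\mathbf{u}\neq\mathbf{0}$ if $\langle \overrightarrow{w_iw_{i+1}},\mathbf{u}\rangle>0$ for all $i$, and monotone if it is monotone in some direction. *)

(* Defs.v *)
From HB Require Import structures.
From mathcomp Require Export all_boot all_order all_algebra.
From mathcomp Require Export all_classical all_reals all_analysis.

Set Implicit Arguments.
Unset Strict Implicit.
Unset Printing Implicit Defensive.

Export Order.TTheory GRing.Theory Num.Theory.
Export numFieldNormedType.Exports.
#[global] Open Scope classical_set_scope.
#[global] Open Scope ring_scope.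

Definition log2 {R : realType} (x : R) : R := ln x / ln 2.

Definition dot {R : realType} (a b : 'rV[R]_2) : R :=
  \sum_(k < 2) a 0 k * b 0 k.

Definition segment {R : realType} (a b : 'rV[R]_2) : set 'rV[R]_2 :=
  [set x | exists2 t : R, 0 <= t <= 1 & x = (1 - t) *: a + t *: b].

Definition all_collinear {R : realType} (n : nat) (p : 'I_n -> 'rV[R]_2) : Prop :=
  exists (a d : 'rV[R]_2), d != 0 /\ forall i, exists t : R, p i = a + t *: d.

(* The vertex i is drawn at p i and the edge {i, j} as the closed segment
   joining p i to p j.  The fourth clause keeps vertices out of the relative
   interior of edges; the fifth one says that two distinct edges can only meet
   at a common endpoint, which excludes crossings and overlaps. *)
Definition plane_straight_line_graph {R : realType} (n : nat)
    (p : 'I_n -> 'rV[R]_2) (e : rel 'I_n) : Prop :=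
  [/\ injective p,
      symmetric e,
      irreflexive e,
      forall i j k, e i j -> segment (p i) (p j) (p k) -> k = i \/ k = j
    & forall i j k l, e i j -> e k l -> [set i; j]%SET <> [set k; l]%SET ->
        forall x, segment (p i) (p j) x -> segment (p k) (p l) x ->
        exists2 v, v \in ([set i; j] :&: [set k; l])%SET & x = p v].

Definition triangulation {R : realType} (n : nat)
    (p : 'I_n -> 'rV[R]_2) (e : rel 'I_n) : Prop :=
  plane_straight_line_graph p e /\
  forall e' : rel 'I_n,
    plane_straight_line_graph p e' -> subrel e e' -> subrel e' e.

(* sorted r w states r for all pairs of consecutive entries of w. *)
Definition graph_path (n : nat) (e : rel 'I_n) (w : seq 'I_n) : Prop :=
  [/\ w <> [::], uniq w & sorted e w].

Definition monotone_in {R : realType} (n : nat) (p : 'I_n -> 'rV[R]_2)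
    (u : 'rV[R]_2) (w : seq 'I_n) : Prop :=
  sorted (fun i j => 0 < dot (p j - p i) u) w.

Definition monotone {R : realType} (n : nat) (p : 'I_n -> 'rV[R]_2)
    (w : seq 'I_n) : Prop :=
  exists2 u : 'rV[R]_2, u != 0 & monotone_in p u w.

(* n.-bseq 'I_n is the finite type of sequences of length at most n, hence it
   contains all paths, their vertices being distinct.  Paths are counted as
   vertex sequences: a path with an edge and its reversal count as two, and
   one-vertex paths are included. *)
Definition num_monotone_paths {R : realType} (n : nat)
    (p : 'I_n -> 'rV[R]_2) (e : rel 'I_n) : nat :=
  #|[set w : n.-bseq 'I_n | `[< graph_path e w /\ monotone p w >]]%SET|.

(* Main.v *)
Require Import Defs.
From mathcomp Require Import zify ring lra.

Set Implicit Arguments.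
Unset Strict Implicit.
Unset Printing Implicit Defensive.

(** Vertex [0] (the apex) is the origin and vertex [t > 0] is the point
[M ^ lev t * (t, 1)], where [lev t] is the 2-adic valuation of [t] and [M] exceeds
[2 n]. The apex is joined to all other vertices, and [i < j] are joined when every
vertex strictly between them has a smaller level than both. Seen from the apex the
vertices occur in the order [1, 2, ...], and a segment between two non-adjacent ones
passes between the apex and a vertex [c] of higher level than one of its ends, so
that it crosses the edge from the apex to [c]; hence the graph is a triangulation.

For a direction [u], the value [<p_t, u>] is [M ^ lev t] times an affine function of
[t]; except for one vertex [t0] nearest to the root of that function, the size of the
values is therefore governed by the levels. A [u]-monotone path thus descends in level
while [<p_t, u> < 0], possibly visits the apex, then ascends in level, up to one
insertion of [t0]. For [n <= 2 ^ K], a vertex has at most two neighbours in each level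
and there are at most [2 ^ (K - 1 - b)] vertices of level [b], so that there are at
most [3 ^ K] level-ascending paths, and [O(K ^ 2 * 3 ^ K)] when one vertex may be
inserted. The number of monotone paths is [O(K ^ 2 * 9 ^ K)]. *)

(** * Levels and ascending paths *)

Section Combinatorics.
Local Open Scope nat_scope.

Definition lev (t : nat) : nat := logn 2 t.

Definition vis (i j : nat) : bool :=
  (i < j) && all (fun c => (lev c < lev i) && (lev c < lev j)) (index_iota i.+1 j).

Definition adj (i j : nat) : bool := vis i j || vis j i.

(** The apex is treated apart: [lev 0] is only the default value [0]. *)
Definition edge (i j : nat) : bool :=
  (i != j) && [|| i == 0, j == 0 | adj i j].

Lemma visP (i j : nat) :
  reflect (i < j /\ forall c, i < c < j -> lev c < lev i /\ lev c < lev j) (vis i j).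
Proof.
apply: (iffP andP) => [[ij /allP h]|[ij h]]; split=> //.
  by move=> c hc; apply/andP/h; rewrite mem_index_iota.
by apply/allP=> c; rewrite mem_index_iota => hc; apply/andP/h.
Qed.

Lemma adjC (i j : nat) : adj i j = adj j i.
Proof. by rewrite /adj orbC. Qed.

Lemma edgeC (i j : nat) : edge i j = edge j i.
Proof. by rewrite /edge eq_sym adjC orbCA. Qed.

Lemma lev_lt (K t : nat) : 0 < t < 2 ^ K -> lev t < K.
Proof.
case/andP=> t0 tK; rewrite -(ltn_exp2l _ _ (isT : 1 < 2)).
by apply: leq_ltn_trans tK; apply: dvdn_leq => //; apply: pfactor_dvdnn.
Qed.

Lemma lev_odd (t : nat) : 0 < t -> exists q, t = 2 ^ lev t * q.*2.+1.
Proof.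
move=> t0; have [||q cq tE] := @pfactor_coprime 2 t => //.
move: cq; rewrite coprime2n => oq; exists q./2.
by rewrite {1}tE mulnC -/(lev t) -{1}(odd_double_half q) oq.
Qed.

(** Two distinct odd multiples of [2 ^ lev i] have an even multiple between them. *)
Lemma lev_between (i j : nat) : 0 < i -> i < j -> lev i = lev j ->
  exists2 c, i < c < j & lev i < lev c.
Proof.
move=> i0 ij eqij; have [a iE] := lev_odd i0.
have [b jE] := lev_odd (ltn_trans i0 ij); rewrite -eqij in jE.
have P0 : 0 < 2 ^ lev i by rewrite expn_gt0.
have ab : a < b by move: ij; rewrite iE jE ltn_pmul2l // ltnS ltn_double.
exists (2 ^ lev i * a.+1.*2).
  by rewrite {1}iE jE !ltn_pmul2l // doubleS ltnSn ltnS -doubleS leq_double.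
rewrite {1}/lev -/(lev i) -pfactor_dvdn //; last by rewrite muln_gt0 P0 double_gt0.
by rewrite expnSr -muln2 dvdn_mul // dvdn_mull.
Qed.

Lemma adj_lev (i j : nat) : 0 < i -> 0 < j -> adj i j -> lev i != lev j.
Proof.
wlog ij : i j / vis i j => [th i0 j0 /orP[] h|i0 _ _].
- by apply: th => //; rewrite /adj h.
- by rewrite eq_sym; apply: th => //; rewrite /adj h.
case/visP: ij => ij h; apply/eqP=> eqij.
have [c hc lc] := lev_between i0 ij eqij.
by have [] := h _ hc; rewrite ltnNge (ltnW lc).
Qed.

(** Failure of [vis] only gives a vertex at least as high as one end; if the levels are equal,
    [lev_between] supplies a strictly higher one. *)
Lemma vis_blocked (i j : nat) : 0 < i -> i < j -> ~~ vis i j ->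
  exists2 c, i < c < j & (lev i < lev c) || (lev j < lev c).
Proof.
move=> i0 ij; rewrite /vis ij /= -has_predC => /hasP[c].
rewrite mem_index_iota => /andP[ic cj] /=; rewrite negb_and -!leqNgt => h.
have [c0 hi hj] : [/\ 0 < c, lev i <= lev c \/ lev j <= lev c & True].
  by split=> //; [apply: ltn_trans ic|apply/orP].
case: hi => [|]; rewrite leq_eqVlt => /orP[/eqP e|l].
- have [d /andP[id dc] ld] := lev_between i0 ic e.
  by exists d; rewrite ?id ?(ltn_trans dc cj) ?ld.
- by exists c; rewrite ?ic ?cj ?l.
- have [d /andP[id dc] ld] := lev_between c0 cj (esym e).
  by exists d; rewrite ?dc ?(ltn_trans ic id) ?e ?ld ?orbT.
- by exists c; rewrite ?ic ?cj ?l ?orbT.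
Qed.

(** If the intervals overlapped properly, [k] and [j] would each be lower than the other. *)
Lemma vis_laminar (i j k l : nat) : vis i j -> vis k l -> ~~ [&& i < k, k < j & j < l].
Proof.
move=> /visP[_ h1] /visP[_ h2]; apply/negP=> /and3P[a b c].
have [|_ x] := h1 k; first by rewrite a b.
have [|y _] := h2 j; first by rewrite b c.
by move: (ltn_trans x y); rewrite ltnn.
Qed.

(** * Enumeration of ascending paths, with or without an inserted vertex *)

Section Counting.
Variables (n K : nat).
Hypothesis nK : n <= 2 ^ K.

Definition verts : seq nat := iota 1 n.-1.

Lemma mem_verts t : (t \in verts) = (0 < t < n).
Proof. by rewrite mem_iota add1n; case: n => [|m] /=; rewrite ?ltn0 ?ltnS //; case: t. Qed.

Lemma verts_lev t : t \in verts -> lev t < K.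
Proof.
by rewrite mem_verts => /andP[t0 tn]; apply: lev_lt; rewrite t0 (leq_trans tn).
Qed.

Definition level_nbrs (b t : nat) : seq nat := [seq v <- verts | adj t v && (lev v == b)].

Lemma size_le1 (T : eqType) (s : seq T) :
  uniq s -> {in s &, forall x y, x = y} -> size s <= 1.
Proof.
case: s => [|x [|y s]] //= /and3P[+ _ _] h.
by rewrite (h x y) ?mem_head // !inE eqxx ?orbT.
Qed.

(** Of two vertices seen by [t] on the same side, the nearer one lies below the farther one. *)
Lemma vis_level_uniq (t v w : nat) : (vis t v && vis t w) || (vis v t && vis w t) ->
  lev v = lev w -> v = w.
Proof.
wlog vw : v w / v < w => [th h e|].
  case: (ltngtP v w) => // [l|l]; first exact: th.
  by apply/esym/th => //; rewrite andbC [X in _ || X]andbC.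
by case/orP=> /andP[/visP[a b] /visP[c d]] e; [case: (d v)|case: (b w)];
  rewrite ?a ?c ?vw // ?e ltnn.
Qed.

Lemma size_level_nbrs b t : size (level_nbrs b t) <= 2.
Proof.
rewrite -(count_predC (ltn t)) -!size_filter -[2]/(1 + 1).
apply: leq_add; apply: size_le1; rewrite ?filter_uniq ?iota_uniq // => v w;
  rewrite !mem_filter /= => /and3P[tv /andP[/orP[] av /eqP lv] _] /and3P[tw /andP[/orP[] aw /eqP lw] _];
  try by [apply: (@vis_level_uniq t); rewrite ?av ?aw ?orbT ?lv].
all: case/visP: av => av _; case/visP: aw => aw _; exfalso; move: tv tw av aw; lia.
Qed.

Definition nbrs (t : nat) : seq nat := flatten [seq level_nbrs b t | b <- iota 0 K].

Lemma size_flatten_le (S T : Type) (F : S -> seq T) (m : nat) (s : seq S) :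
  (forall x, size (F x) <= m) -> size (flatten [seq F x | x <- s]) <= m * size s.
Proof.
move=> h; elim: s => //= x s IH; rewrite size_cat mulnS.
exact: leq_add.
Qed.

Lemma size_nbrs t : size (nbrs t) <= 2 * K.
Proof.
rewrite -[X in _ <= _ * X](size_iota 0 K).
by apply: size_flatten_le => b; apply: size_level_nbrs.
Qed.

Lemma mem_level_nbrs t v : (v \in level_nbrs (lev v) t) = (v \in verts) && adj t v.
Proof. by rewrite mem_filter eqxx andbT andbC. Qed.

Lemma mem_nbrs t v : v \in verts -> adj t v -> v \in nbrs t.
Proof.
move=> hv tv; apply/flattenP; exists (level_nbrs (lev v) t); last by rewrite mem_level_nbrs hv.
by apply: map_f; rewrite mem_iota verts_lev.
Qed.

Definition asc (p : seq nat) : bool :=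
  all (mem verts) p && sorted (fun x y => adj x y && (lev x < lev y)) p.

(* All nonempty ascending paths whose first vertex has level at least [K - j]. *)
Fixpoint climbs (j : nat) : seq (seq nat) :=
  if j is i.+1 then
    climbs i ++ [seq [:: v] | v <- verts & lev v == K - j]
      ++ flatten [seq [seq v :: p | v <- level_nbrs (K - j) (head 0 p)] | p <- climbs i]
  else [::].

(** A vertex of level [b] is [2 ^ b * (2 q + 1)], so it is determined by [q = v %/ 2 ^ b.+1], which
    is less than [2 ^ (K - b.+1)]. *)
Lemma count_lev b : b < K -> size [seq v <- verts | lev v == b] <= 2 ^ (K - b.+1).
Proof.
move=> bK; set s := [seq v <- verts | _].
have sE v : v \in s -> v = 2 ^ b * (v %/ 2 ^ b.+1).*2.+1 /\ v < 2 ^ K.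
  rewrite mem_filter mem_verts => /and3P[/eqP <- v0 vn].
  split; last exact: leq_trans nK.
  have [q E] := lev_odd v0; set l := lev v in E *.
  suff -> : v %/ 2 ^ l.+1 = q by [].
  by rewrite E expnSr divnMA mulKn ?expn_gt0 // -addn1 -muln2 divnMDl // addn0.
rewrite -(size_iota 0 (2 ^ _)) -(size_map (fun v => v %/ 2 ^ b.+1)).
apply: uniq_leq_size.
  rewrite map_inj_in_uniq ?filter_uniq ?iota_uniq // => v w /sE[ev _] /sE[ew _] e.
  by rewrite ev ew e.
move=> _ /mapP[v /sE[_ vK] ->]; rewrite mem_iota /= add0n.
by rewrite ltn_divLR ?expn_gt0 // -expnD subnK.
Qed.

(** The summand [2 ^ j] strengthens the induction: at most [2 ^ j] one-vertex paths are new, and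
    each old path has at most two extensions, so the sizes satisfy [a' <= 3 a + 2 ^ j]. *)
Lemma size_climbs j : j <= K -> size (climbs j) + 2 ^ j <= 3 ^ j.
Proof.
elim: j => // j IH jK; have := IH (ltnW jK).
rewrite /climbs -/climbs !size_cat size_map.
have := @count_lev (K - j.+1); rewrite subnSK // leq_subr => /(_ isT).
rewrite subKn ?(ltnW jK) //.
have h p : size [seq v :: p | v <- level_nbrs (K - j.+1) (head 0 p)] <= 2.
  by rewrite size_map size_level_nbrs.
have := size_flatten_le (climbs j) h; rewrite /= !expnS; lia.
Qed.

Lemma size_climbs_le j : j <= K -> size (climbs j) <= 3 ^ j.
Proof. by move/size_climbs; apply: leq_trans; apply: leq_addr. Qed.

Lemma mem_climbs j p : j <= K -> p != [::] -> asc p -> K - j <= lev (head 0 p) ->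
  p \in climbs j.
Proof.
elim: j p => [|j IH] [//|v p] jK _ /andP[/= /andP[hv hp] sp].
  by rewrite subn0 leqNgt verts_lev.
rewrite leq_eqVlt => /orP[/eqP e|l]; rewrite !mem_cat; last first.
  by rewrite IH ?(ltnW jK) // ?/asc /= ?hv ?hp // -subnSK.
apply/orP; right; rewrite e; case: p hp sp => [_ _|w p] /=.
  by apply/orP; left; apply: map_f; rewrite mem_filter eqxx.
move=> /andP[hw hp] /andP[/andP[avw lvw] sp]; apply/orP; right.
apply/flattenP; exists [seq v :: w :: p | v <- level_nbrs (lev v) w].
  apply/mapP; exists (w :: p) => //; apply: IH; rewrite ?(ltnW jK) //.
    by rewrite /asc /= hw hp.
  by rewrite /= -subnSK // e.
by apply: map_f; rewrite mem_level_nbrs hv adjC.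
Qed.

(* All extensions [q ++ p] of [p] by an ascending path [q] (or [[::]]) that ends in a
   neighbour of the head of [p] of level less than [c]. *)
Fixpoint prefixings (c : nat) (p : seq nat) : seq (seq nat) :=
  if c is b.+1 then
    prefixings b p ++ flatten [seq prefixings b (v :: p) | v <- level_nbrs b (head 0 p)]
  else [:: p].

Lemma size_prefixings c p : size (prefixings c p) <= 3 ^ c.
Proof.
elim: c p => //= c IH p; rewrite size_cat expnS.
have := @size_flatten_le _ _ (fun v => prefixings c (v :: p)) _ (level_nbrs c (head 0 p)) (fun v => IH (v :: p)).
have := IH p; have := size_level_nbrs c (head 0 p); nia.
Qed.

(** Induction on [c]: the last vertex of [q] moves to the front of [p] when its level is exactly the
    largest one allowed. *)
Lemma mem_prefixings c q p : asc q ->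
  (q == [::]) || (lev (last 0 q) < c) && adj (last 0 q) (head 0 p) ->
  q ++ p \in prefixings c p.
Proof.
elim: c q p => [|c IH] q p aq /=.
  by rewrite orbF => /eqP->; rewrite mem_head.
rewrite ltnS leq_eqVlt => h; rewrite mem_cat.
case/lastP: q aq h => [|q v] aq; first by move=> _; rewrite IH.
rewrite last_rcons => /orP[/eqP|/andP[/orP[/eqP e|l] a]]; first by case: q aq.
- apply/orP; right; apply/flattenP; exists (prefixings c (v :: p)).
    apply: map_f; rewrite -e mem_level_nbrs adjC a andbT.
    by move: aq; rewrite /asc all_rcons -andbA => /and3P[].
  rewrite cat_rcons; apply: IH.
    move: aq; rewrite /asc all_rcons => /andP[/andP[_ ->]] /=.
    by case: q => //= x q; rewrite rcons_path => /andP[].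
  move: aq; rewrite /asc => /andP[_]; case: q => //= x q.
  by rewrite rcons_path -e => /andP[_ /andP[-> ->]].
- by rewrite IH // last_rcons l a orbT.
Qed.

(** The inserted vertex comes last. *)
Definition capped : seq (seq nat) :=
  flatten [seq [seq rcons p t | t <- nbrs (last 0 p)] | p <- climbs K].

(** The inserted vertex [t] is followed by [p], whose levels are at least [b], and preceded by
    vertices of level at most [b]. *)
Definition spliced : seq (seq nat) :=
  flatten [seq flatten [seq flatten [seq prefixings b.+1 (t :: p) | t <- nbrs (head 0 p)]
                       | p <- climbs (K - b)] | b <- iota 0 K].

(* Contains every path [p1 ++ t :: p2] with [p1] and [p2] ascending and the level of the
   last vertex of [p1] not exceeding that of the first one of [p2]; nothing is known about
   the level of the inserted vertex [t]. *)
Definition inserted : seq (seq nat) := [::] :: climbs K ++ capped ++ spliced.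

Lemma size_capped : size capped <= 2 * K * 3 ^ K.
Proof.
apply: (@leq_trans (2 * K * size (climbs K))).
  by apply: size_flatten_le => p; rewrite size_map size_nbrs.
by rewrite leq_mul2l size_climbs_le ?orbT.
Qed.

(** Each [b] contributes at most [3 ^ b.+1 * (2 * K) * 3 ^ (K - b) = 6 * K * 3 ^ K]: as the two
    pieces share the levels, the power of 3 does not double. *)
Lemma size_spliced : size spliced <= 6 * K * 3 ^ K * K.
Proof.
rewrite -[X in _ <= _ * X](size_iota 0 K); apply: size_flatten_le => b.
(* The bound is required for every [b]; beyond [K] the list [climbs 0] is empty. *)
case: (leqP b K) => bK; last first.
  by rewrite (_ : K - b = 0) //; apply/eqP; rewrite subn_eq0 ltnW.
apply: (@leq_trans (3 ^ b.+1 * (2 * K) * size (climbs (K - b)))).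
  apply: size_flatten_le => p; apply: (@leq_trans (3 ^ b.+1 * size (nbrs (head 0 p)))).
    by apply: size_flatten_le => t; apply: size_prefixings.
  by rewrite leq_mul2l size_nbrs orbT.
have := size_climbs_le (leq_subr b K).
by rewrite -[in 3 ^ K](subnKC bK) expnD expnS; nia.
Qed.

Lemma size_inserted : 0 < K -> size inserted <= 10 * K ^ 2 * 3 ^ K.
Proof.
move=> K0; rewrite [size _]/= !size_cat.
have := size_climbs_le (leqnn K); have := size_capped; have := size_spliced.
have h4 : 1 <= 3 ^ K by rewrite expn_gt0.
rewrite expnS expn1; nia.
Qed.

Lemma mem_inserted p1 t p2 : t \in verts -> asc p1 -> asc p2 ->
  (p1 == [::]) || adj (last 0 p1) t -> (p2 == [::]) || adj t (head 0 p2) ->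
  [|| p1 == [::], p2 == [::] | lev (last 0 p1) <= lev (head 0 p2)] ->
  p1 ++ t :: p2 \in inserted.
Proof.
move=> ht a1 a2 h1 h2 h12; rewrite inE; apply/orP; right; rewrite !mem_cat.
have climbK p : p != [::] -> asc p -> p \in climbs K.
  by move=> p0 ap; apply: mem_climbs => //; rewrite subnn.
have [E2|N2] := eqVneq p2 [::].
  have [->|N1] := eqVneq p1 [::].
    by rewrite E2 climbK // /asc /= ht.
  apply/orP; right; apply/orP; left; apply/flattenP.
  exists [seq rcons p1 t | t <- nbrs (last 0 p1)].
    by apply/mapP; exists p1 => //; apply: climbK.
  rewrite E2 cats1; apply: map_f; apply: mem_nbrs => //.
  by move: h1; rewrite (negbTE N1).
apply/orP; right; apply/orP; right.
have hh : head 0 p2 \in verts by case: p2 a2 N2 {h2 h12} => //= w p2 /andP[/andP[]].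
rewrite (negbTE N2) /= in h2 h12.
set b := lev (head 0 p2) in h12 *.
have bK : b < K by apply: verts_lev.
apply/flattenP; eexists; first by apply/mapP; exists b; rewrite ?mem_iota.
apply/flattenP; eexists.
  apply/mapP; exists p2; last reflexivity.
  by apply: mem_climbs; rewrite ?leq_subr // subKn // ltnW.
apply/flattenP; eexists.
  by apply/mapP; exists t; last reflexivity; apply: mem_nbrs; rewrite // adjC.
apply: mem_prefixings => //.
by case: eqP h1 h12 => //= _ -> h; rewrite ltnS h.
Qed.

Definition ascents : seq (seq nat) := [::] :: climbs K.

Lemma mem_ascents p : asc p -> p \in ascents.
Proof.
move=> ap; rewrite inE; case: eqP => //= /eqP p0.
by apply: mem_climbs => //; rewrite subnn.
Qed.

(** Descend along [rev p], visit the apex or not, ascend along [q]. *)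
Definition joins (l r : seq (seq nat)) : seq (seq nat) :=
  flatten [seq flatten [seq [seq rev p ++ z ++ q | z <- [:: [::]; [:: 0]]] | q <- r]
          | p <- l].

Lemma size_joins l r : size (joins l r) <= 2 * size r * size l.
Proof. by apply: size_flatten_le => p; apply: size_flatten_le. Qed.

Lemma mem_joins l r p z q : p \in l -> q \in r -> z \in [:: [::]; [:: 0]] ->
  rev p ++ z ++ q \in joins l r.
Proof.
move=> hp hq hz; apply/flattenP; eexists; first by apply/mapP; exists p; first exact: hp.
apply/flattenP; eexists; first by apply/mapP; exists q; first exact: hq.
exact: (map_f (fun z => rev p ++ z ++ q)).
Qed.

(** The exceptional vertex is inserted in at most one of the two halves. *)
Definition candidates : seq (seq nat) :=
  joins ascents inserted ++ joins inserted ascents.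

Lemma size_candidates : 0 < K -> size candidates <= 80 * K ^ 2 * 9 ^ K.
Proof.
move=> K0; rewrite size_cat.
apply: leq_trans (leq_add (size_joins _ _) (size_joins _ _)) _.
have h1 : size ascents <= 2 * 3 ^ K.
  have := size_climbs_le (leqnn K); have : 1 <= 3 ^ K by rewrite expn_gt0.
  by rewrite [size ascents]/=; lia.
have e9 : 9 ^ K = 3 ^ K * 3 ^ K by rewrite -expnMn.
have := leq_mul h1 (size_inserted K0); rewrite e9.
move: (size ascents) (size inserted) (3 ^ K) (K ^ 2) => a i T X; nia.
Qed.

End Counting.

End Combinatorics.

(** * The drawing is a triangulation *)

Section Geometry.
Variable R : realType.
Implicit Types (a b x : 'rV[R]_2) (M : R).

Lemma dotE a b : dot a b = a 0 0 * b 0 0 + a 0 1 * b 0 1.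
Proof. by rewrite /dot !big_ord_recl big_ord0 addr0; congr (_ + _ 0 _ * b 0 _); apply/val_inj. Qed.

Lemma dot_segment u (t : R) a b :
  dot ((1 - t) *: a + t *: b) u = (1 - t) * dot a u + t * dot b u.
Proof. by rewrite !dotE !mxE; ring. Qed.

Lemma segmentC a b x : segment a b x -> segment b a x.
Proof.
move=> [t ht ->]; exists (1 - t); first by lra.
by rewrite subKr addrC.
Qed.

(** Inside the first segment the form [u] is less than [g], on the second one it is at least [g]. *)
Lemma segment_separated u (g : R) a b c d x :
  dot a u <= g -> dot b u <= g -> dot a u < g \/ dot b u < g ->
  g <= dot c u -> g <= dot d u ->
  segment a b x -> segment c d x -> x = a \/ x = b.
Proof.
move=> ha hb hab hc hd [t ht xE] [s hs xE'].
have e := dot_segment u t a b; have e' := dot_segment u s c d.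
rewrite -xE in e; rewrite -xE' in e'.
have [t0|t0] := eqVneq t 0; first by left; rewrite xE t0 subr0 scale1r scale0r addr0.
have [t1|t1] := eqVneq t 1; first by right; rewrite xE t1 subrr scale1r scale0r add0r.
exfalso; case/andP: ht => ht0 ht1.
have {}t0 : 0 < t by rewrite lt_neqAle eq_sym t0.
have {}t1 : t < 1 by rewrite lt_neqAle t1.
have : g <= dot x u by rewrite e'; nra.
by rewrite e; case: hab => h; nra.
Qed.

(** The value at [0] puts the apex at the origin; [M ^+ lev 0] would be [1]. *)
Definition rad M (t : nat) : R := if t == 0%N then 0 else M ^+ lev t.

Definition pt M (t : nat) : 'rV[R]_2 :=
  rad M t *: \row_(k < 2) (if k == 0 then t%:R else 1).

Lemma dot_pt M t u : dot (pt M t) u = rad M t * (t%:R * u 0 0 + u 0 1).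
Proof. by rewrite dotE !mxE /=; ring. Qed.

Definition vec (s t : R) : 'rV[R]_2 := \row_(k < 2) (if k == 0 then s else t).

Lemma dot_pt_vec M t (s r : R) : dot (pt M t) (vec s r) = rad M t * (t%:R * s + r).
Proof. by rewrite dot_pt !mxE. Qed.

(** * Position of the vertices relative to chords and rays *)

Section Bound.
Variables (M : R) (n : nat).
Hypotheses (M1 : 1 < M) (nM : n%:R <= M).

Lemma rad0 : rad M 0 = 0. Proof. by []. Qed.

Lemma rad_ge1 t : (0 < t)%N -> 1 <= rad M t.
Proof. by rewrite /rad; case: eqP => [->//|_ _]; rewrite exprn_ege1 // ltW. Qed.

Lemma rad_ge0 t : 0 <= rad M t.
Proof. by case: t => [//|t]; apply: le_trans (rad_ge1 _). Qed.

Lemma rad_lt s t : (0 < s)%N -> (0 < t)%N -> (lev s < lev t)%N -> M * rad M s <= rad M t.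
Proof.
rewrite /rad; case: eqP => [->//|_]; case: eqP => [->//|_] _ _ l.
by rewrite -exprS ler_weXn2l // ltW.
Qed.

(* [chord i j] is normal to the line through [pt M i] and [pt M j]. *)
Definition chord (i j : nat) : 'rV[R]_2 :=
  vec (rad M j - rad M i) (rad M i * i%:R - rad M j * j%:R).

Lemma dot_chord i j t : dot (pt M t) (chord i j) =
  - (rad M t * (rad M j * (j%:R - t%:R) + rad M i * (t%:R - i%:R))).
Proof. by rewrite dot_pt_vec; ring. Qed.

Lemma dot_chord_left i j : dot (pt M i) (chord i j) = - (rad M i * rad M j * (j%:R - i%:R)).
Proof. by rewrite dot_chord; ring. Qed.

Lemma dot_chord_right i j : dot (pt M j) (chord i j) = - (rad M i * rad M j * (j%:R - i%:R)).
Proof. by rewrite dot_chord; ring. Qed.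

(** A vertex strictly between [i] and [j] lies on the apex side of the chord, its factor [rad M t]
    being smaller than those of both ends. *)
Lemma dot_chord_vis i j t : (0 < i)%N -> vis i j -> (i < t < j)%N ->
  - (rad M i * rad M j * (j%:R - i%:R)) < dot (pt M t) (chord i j).
Proof.
move=> i0 /visP[ij h] htj; have [li lj] := h _ htj; case/andP: htj => it tj.
have t0 := ltn_trans i0 it; have j0 := ltn_trans t0 tj.
rewrite dot_chord ltrN2.
have := rad_lt t0 i0 li; have := rad_lt t0 j0 lj.
have := rad_ge1 i0; have := rad_ge1 t0; have := rad_ge1 j0.
move: it tj; rewrite -!(ltr_nat R).
move: (rad M i) (rad M j) (rad M t) (i%:R : R) (j%:R : R) (t%:R : R) => ri rj rt x y z.
move=> xz zy hj ht hi h1 h2.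
have {}h1 : rt < rj by apply: lt_le_trans h1; rewrite ltr_pMl //; lra.
have {}h2 : rt < ri by apply: lt_le_trans h2; rewrite ltr_pMl //; lra.
have a1 : rt * rj * (y - z) < ri * rj * (y - z) by rewrite ltr_pM2r ?subr_gt0 // ltr_pM2r //; lra.
have a2 : rt * ri * (z - x) < ri * rj * (z - x).
  by rewrite ltr_pM2r ?subr_gt0 // mulrC ltr_pM2l //; lra.
lra.
Qed.

Lemma dot_chord_apex i j : (0 < i < j)%N ->
  - (rad M i * rad M j * (j%:R - i%:R)) < dot (pt M 0) (chord i j).
Proof.
move=> /andP[i0 ij]; rewrite dot_chord rad0 mul0r oppr0 oppr_lt0.
have hi := rad_ge1 i0; have hj := rad_ge1 (ltn_trans i0 ij).
by rewrite !mulr_gt0 ?subr_gt0 ?ltr_nat //; lra.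
Qed.

(* [ray j] is normal to the line through the apex and [pt M j]. *)
Definition ray (j : nat) : 'rV[R]_2 := vec 1 (- j%:R).

Lemma dot_ray j t : dot (pt M t) (ray j) = rad M t * (t%:R - j%:R).
Proof. by rewrite dot_pt_vec mulr1. Qed.

Lemma dot_ray_le0 j t : (t == 0%N) || (t <= j)%N -> dot (pt M t) (ray j) <= 0.
Proof.
rewrite dot_ray => /orP[/eqP->|tj]; first by rewrite rad0 mul0r.
by rewrite mulr_ge0_le0 ?rad_ge0 // subr_le0 ler_nat.
Qed.

Lemma dot_ray_ge0 j t : (t == 0%N) || (j <= t)%N -> 0 <= dot (pt M t) (ray j).
Proof.
rewrite dot_ray => /orP[/eqP->|tj]; first by rewrite rad0 mul0r.
by rewrite mulr_ge0 ?rad_ge0 // subr_ge0 ler_nat.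
Qed.

Lemma dot_ray_lt0 j t : (0 < t < j)%N -> dot (pt M t) (ray j) < 0.
Proof.
move=> /andP[t0 tj]; rewrite dot_ray pmulr_rlt0 ?subr_lt0 ?ltr_nat //.
by apply: lt_le_trans (rad_ge1 t0).
Qed.

Lemma dot_ray_gt0 j t : (j < t)%N -> 0 < dot (pt M t) (ray j).
Proof.
move=> jt; rewrite dot_ray pmulr_rgt0 ?subr_gt0 ?ltr_nat //.
by apply: lt_le_trans (rad_ge1 _); rewrite ?(leq_ltn_trans _ jt).
Qed.

Lemma pt_inj : injective (pt M).
Proof.
move=> i j; wlog ij : i j / (i < j)%N => [th e|e].
  by case: (ltngtP i j) => // l; [apply: th|apply/esym/th].
have := dot_ray_gt0 ij; rewrite -e => h.
by have := dot_ray_le0 (j := i) (t := i); rewrite leqnn orbT => /(_ isT); rewrite leNgt h.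
Qed.

Lemma segment_le u (g : R) a b x :
  dot a u <= g -> dot b u <= g -> segment a b x -> dot x u <= g.
Proof. by move=> ha hb [t ht ->]; rewrite dot_segment; nra. Qed.

(** A line separates any other vertex from the edge: a ray through an end if the vertex is outside
    the angle spanned at the apex, the chord itself if it is inside or is the apex. *)
Lemma edge_vertex i j k : edge i j -> segment (pt M i) (pt M j) (pt M k) -> k = i \/ k = j.
Proof.
wlog ij : i j / (i < j)%N => [th e s|].
  case: (ltngtP i j) => [l|l|l]; first exact: th.
    by rewrite edgeC in e; case: (th _ _ l e (segmentC s)); [right|left].
  by rewrite l /edge eqxx in e.
rewrite /edge => /andP[_ e] s.
have segE u g : dot (pt M i) u <= g -> dot (pt M j) u <= g -> ~ g < dot (pt M k) u.
  by move=> h1 h2; apply/negP; rewrite -leNgt; apply: segment_le s.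
have segN u g : g <= dot (pt M i) u -> g <= dot (pt M j) u -> ~ dot (pt M k) u < g.
  have dN a : dot a (- u) = - dot a u by rewrite !dotE !mxE; ring.
  move=> h1 h2; rewrite -ltrN2 -dN; apply/negP; rewrite -leNgt.
  by apply: segment_le s; rewrite dN lerN2.
have [i0|i0] := posnP i; subst.
  have [k0|k0] := posnP k; first by left.
  right; case: (ltngtP k j) => // l.
    have := segN (ray j) 0; rewrite dot_ray_ge0 // dot_ray_ge0 ?leqnn ?orbT //.
    by rewrite dot_ray_lt0 ?k0 // => /(_ isT isT); case.
  have := segE (ray j) 0; rewrite dot_ray_le0 // dot_ray_le0 ?leqnn ?orbT //.
  by rewrite dot_ray_gt0 // => /(_ isT isT); case.
have vij : vis i j.
  move: e; rewrite /adj (gtn_eqF i0) (gtn_eqF (ltn_trans i0 ij)) /= => /orP[//|/visP[]].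
  by rewrite ltnNge (ltnW ij).
have [k0|k0] := posnP k; subst.
  by exfalso; apply: (segE _ _ _ _ (dot_chord_apex (i := i) (j := j) _));
    rewrite ?dot_chord_left ?dot_chord_right ?i0.
have [ki|ik|->] := ltngtP k i; last by left.
  exfalso; apply: (segN _ _ _ _ (dot_ray_lt0 (t := k) (j := i) _));
    by rewrite ?k0 ?dot_ray_ge0 ?leqnn ?(ltnW ij) ?orbT.
have [kj|jk|->] := ltngtP k j; last by right.
  by exfalso; apply: (segE _ _ _ _ (dot_chord_vis i0 vij (t := k) _));
    rewrite ?dot_chord_left ?dot_chord_right ?ik.
by exfalso; apply: (segE _ _ _ _ (dot_ray_gt0 jk));
  rewrite ?dot_ray_le0 ?leqnn ?(ltnW ij) ?orbT.
Qed.

(** Some ray or chord has the two edges on opposite closed sides and not all four ends on it, so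
    that one edge meets it at most in an end. *)
Lemma edge_cross i j k l x : edge i j -> edge k l ->
  ~ (i = k /\ j = l) -> ~ (i = l /\ j = k) ->
  segment (pt M i) (pt M j) x -> segment (pt M k) (pt M l) x ->
  exists2 v, v \in [:: i; j; k; l] & x = pt M v.
Proof.
have inl (a b v1 v2 : nat) : x = pt M v1 \/ x = pt M v2 ->
    exists2 v, v \in [:: v1; v2; a; b] & x = pt M v.
  by case=> ->; [exists v1|exists v2]; rewrite ?inE ?eqxx ?orbT.
have inr (a b v1 v2 : nat) : x = pt M v1 \/ x = pt M v2 ->
    exists2 v, v \in [:: a; b; v1; v2] & x = pt M v.
  by case=> ->; [exists v1|exists v2]; rewrite ?inE ?eqxx ?orbT.
have sepr u g (a b c d : nat) : dot (pt M a) u <= g -> dot (pt M b) u <= g ->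
    g <= dot (pt M c) u -> g <= dot (pt M d) u ->
    dot (pt M a) u < g \/ dot (pt M b) u < g \/ g < dot (pt M c) u \/ g < dot (pt M d) u ->
    segment (pt M a) (pt M b) x -> segment (pt M c) (pt M d) x ->
    exists2 v, v \in [:: a; b; c; d] & x = pt M v.
  move=> ha hb hc hd H s1 s2.
  have [h|h] : (dot (pt M a) u < g \/ dot (pt M b) u < g) \/
      (g < dot (pt M c) u \/ g < dot (pt M d) u) by tauto.
    exact/inl/(segment_separated ha hb h hc hd s1 s2).
  (* The strict inequality concerns the second segment: negating the form exchanges the roles. *)
  apply/inr; have dN y : dot y (- u) = - dot y u by rewrite !dotE !mxE; ring.
  by apply: (segment_separated (u := - u) (g := - g) _ _ _ _ _ s2 s1); rewrite ?dN ?lerN2 ?ltrN2.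
have swap (a b c d : nat) : (exists2 v, v \in [:: c; d; a; b] & x = pt M v) ->
    exists2 v, v \in [:: a; b; c; d] & x = pt M v.
  by case=> v; rewrite !inE => hv ->; exists v; rewrite // !inE; move: hv; do !case: eqP.
have flip (a b c d : nat) : (exists2 v, v \in [:: b; a; c; d] & x = pt M v) ->
    exists2 v, v \in [:: a; b; c; d] & x = pt M v.
  by case=> v; rewrite !inE => hv ->; exists v; rewrite // !inE orbCA.
wlog ij : i j / (i < j)%N => [th e1 e2 d1 d2 s1 s2|].
  case: (ltngtP i j) => [h|h|h]; first exact: th.
    by apply: flip; apply: (th _ _ h _ e2 _ _ (segmentC s1) s2); [rewrite edgeC|tauto|tauto].
  by rewrite h /edge eqxx in e1.
wlog kl : k l / (k < l)%N => [th e1 e2 d1 d2 s1 s2|].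
  case: (ltngtP k l) => [h|h|h]; first exact: th.
    by apply/swap/flip/swap; apply: (th _ _ h e1 _ _ _ s1 (segmentC s2)); [rewrite edgeC|tauto|tauto].
  by rewrite h /edge eqxx in e2.
have visE (a b : nat) : (0 < a)%N -> (a < b)%N -> edge a b -> vis a b.
  move=> a0 ab /andP[_]; rewrite /adj (gtn_eqF a0) (gtn_eqF (ltn_trans a0 ab)) /=.
  by case/orP=> // /visP[]; rewrite ltnNge (ltnW ab).
wlog ik : i j k l ij kl / (i <= k)%N => [th|e1 e2 d1 _ s1 s2].
  case/orP: (leq_total i k) => h; first exact: th.
  by move=> e1 e2 d1 d2 s1 s2; apply: swap; apply: (th k l i j) => // -[? ?]; subst; [apply: d1|apply: d2].
have j0 : (0 < j)%N := leq_ltn_trans (leq0n _) ij.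
have l0 : (0 < l)%N := leq_ltn_trans (leq0n _) kl.
have chordE (a b t : nat) : (0 < a)%N -> vis a b -> (t == 0%N) || (a <= t <= b)%N ->
    - (rad M a * rad M b * (b%:R - a%:R)) <= dot (pt M t) (chord a b).
  move=> a0 vab /orP[/eqP->|]; first by rewrite ltW // dot_chord_apex // a0; case/visP: vab.
  rewrite leq_eqVlt [(t <= b)%N]leq_eqVlt.
  case/andP=> /predU1P[<-|h1]; first by rewrite dot_chord_left.
  by case/predU1P=> [->|h2]; rewrite ?dot_chord_right // ltW // dot_chord_vis ?h1.
(* Two apex edges are separated by the ray of smaller index. An apex edge to [j] and a chord from
   [k] to [l] are separated by the chord if [k <= j <= l], by a ray through an end of the chord
   otherwise. *)
have [i0|i0] := posnP i; last have k0 := leq_trans i0 ik.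
  have [k0|k0] := posnP k.
    have [jl|lj|e] := ltngtP j l; last by case: d1; rewrite i0 k0 e.
      apply: (sepr (ray j) 0) => //; rewrite ?i0 ?k0 ?dot_ray_le0 ?dot_ray_ge0 ?leqnn ?(ltnW jl) ?orbT //.
      by right; right; right; apply: dot_ray_gt0; exact: jl.
    apply/swap/(sepr (ray l) 0) => //; rewrite ?i0 ?k0 ?dot_ray_le0 ?dot_ray_ge0 ?leqnn ?(ltnW lj) ?orbT //.
    by right; right; right; apply: dot_ray_gt0; exact: lj.
  have vkl := visE _ _ k0 kl e2.
  have [jk|kj] := ltnP j k.
    apply: (sepr (ray k) 0) => //; rewrite ?i0 ?dot_ray_le0 ?dot_ray_ge0 ?leqnn ?(ltnW jk) ?(ltnW kl) ?orbT //.
    by right; right; right; apply: dot_ray_gt0; exact: kl.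
  have [lj|jl] := ltnP l j.
    apply/swap/(sepr (ray l) 0) => //; rewrite ?i0 ?dot_ray_le0 ?dot_ray_ge0 ?leqnn ?(ltnW lj) ?(ltnW kl) ?orbT //.
    by right; right; right; apply: dot_ray_gt0; exact: lj.
  apply/swap/(sepr (chord k l) _ _ _ _ _ _ _ (chordE _ _ i k0 vkl _) (chordE _ _ j k0 vkl _)) => //;
    rewrite ?dot_chord_left ?dot_chord_right ?i0 ?kj ?jl ?orbT //.
  by right; right; left; rewrite ?i0 dot_chord_apex ?k0.
(* Two chords span intervals without common interior, separated by the ray through [j], or nested
   ones by [vis_laminar], separated by the outer chord. *)
have vkl := visE _ _ k0 kl e2; have vij := visE _ _ i0 ij e1.
have [jk|kj] := leqP j k.
  apply: (sepr (ray j) 0) => //; rewrite ?dot_ray_le0 ?dot_ray_ge0 ?jk ?leqnn ?(ltnW ij) ?(leq_trans jk (ltnW kl)) ?orbT //.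
  by right; right; right; apply: dot_ray_gt0; exact: (leq_ltn_trans jk kl).
have [e|ik'] := eqVneq i k; first subst k.
  have [lj|jl|e'] := ltngtP l j; last by case: d1.
    apply: (sepr (chord i j) _ _ _ _ _ _ _ (chordE _ _ i i0 vij _) (chordE _ _ l i0 vij _)) => //;
      rewrite ?dot_chord_left ?dot_chord_right ?leqnn ?(ltnW ij) ?(ltnW lj) ?(ltnW kl) ?orbT //.
    by right; right; right; apply: dot_chord_vis; rewrite // kl lj.
  apply/swap/(sepr (chord i l) _ _ _ _ _ _ _ (chordE _ _ i i0 vkl _) (chordE _ _ j i0 vkl _)) => //;
      rewrite ?dot_chord_left ?dot_chord_right ?leqnn ?(ltnW ij) ?(ltnW jl) ?(ltnW kl) ?orbT //.
    by right; right; right; apply: dot_chord_vis; rewrite // kj jl.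
have {}ik' : (i < k)%N by rewrite ltn_neqAle ik'.
have lj : (l <= j)%N by have := vis_laminar vij vkl; rewrite ik' kj /= -leqNgt.
apply: (sepr (chord i j) _ _ _ _ _ _ _ (chordE _ _ k i0 vij _) (chordE _ _ l i0 vij _)) => //;
  rewrite ?dot_chord_left ?dot_chord_right ?ik ?(ltnW kj) ?lj ?(leq_trans ik (ltnW kl)) ?orbT //.
by right; right; left; apply: dot_chord_vis; rewrite // ik' kj.
Qed.

Lemma chord_meets_ray i j c : (0 < i)%N -> (i < c < j)%N -> (j < n)%N ->
  (lev i < lev c)%N || (lev j < lev c)%N ->
  exists x, segment (pt M i) (pt M j) x /\ segment (pt M 0) (pt M c) x.
Proof.
move=> i0 /andP[ic cj] jn hl.
have c0 := ltn_trans i0 ic; have j0 := ltn_trans c0 cj.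
have hi := rad_ge1 i0; have hj := rad_ge1 j0; have hc := rad_ge1 c0.
(* The line from the apex through [c] divides the chord in the ratio [p : q], at the height [d]
   defined below. *)
pose p : R := rad M i * (c%:R - i%:R); pose q : R := rad M j * (j%:R - c%:R).
have p0 : 0 < p by rewrite mulr_gt0 ?subr_gt0 ?ltr_nat //; lra.
have q0 : 0 < q by rewrite mulr_gt0 ?subr_gt0 ?ltr_nat //; lra.
have pq0 : 0 < p + q by rewrite addr_gt0.
pose d := rad M i * rad M j * (j%:R - i%:R) / (p + q).
exists ((d / rad M c) *: pt M c); split.
  exists (p / (p + q)).
    by rewrite divr_ge0 ?(ltW p0) ?(ltW pq0) //= ler_pdivrMr // mul1r lerDl ltW.
  apply/rowP => k; rewrite !mxE; case: (k == 0).
    rewrite /d /p /q; field; apply/andP; split; rewrite ?lt0r_neq0 //; lra.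
  rewrite /d /p /q; field; apply/andP; split; rewrite ?lt0r_neq0 //; lra.
exists (d / rad M c); last by rewrite [pt M 0]/pt rad0 scale0r scaler0 add0r.
have d0 : 0 <= d.
  by rewrite /d divr_ge0 ?(ltW pq0) // !mulr_ge0 ?rad_ge0 // subr_ge0 ler_nat ltnW // (ltn_trans ic).
rewrite divr_ge0 ?rad_ge0 //= ler_pdivrMr ?mul1r; last lra.
rewrite /d ler_pdivrMr //.
have M0 : 0 < M := lt_trans ltr01 M1.
have ji : j%:R - i%:R <= M :> R.
  by apply: le_trans nM; rewrite lerBlDr -natrD ler_nat (leq_trans (ltnW jn)) ?leq_addr.
have ji0 : 0 <= j%:R - i%:R :> R by rewrite subr_ge0 ler_nat ltnW // (ltn_trans ic).
have dic : 1 <= c%:R - i%:R :> R by rewrite lerBrDr -[X in X + _]/(1%:R) -natrD add1n ler_nat.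
have dcj : 1 <= j%:R - c%:R :> R by rewrite lerBrDr -[X in X + _]/(1%:R) -natrD add1n ler_nat.
(* This yields [d <= rad M c]: the factor [M] gained from the higher level of [c] outweighs
   [j - i < n <= M], while [c] is at distance at least 1 from either end. *)
have key (a b r J D : R) : 0 <= a -> 0 <= b -> M * a <= r -> 0 <= J -> J <= M -> 1 <= D ->
    b * a * J <= r * (b * D).
  move=> a0 b0 ar J0 JM D1; rewrite -mulrA [leRHS]mulrCA ler_wpM2l //.
  by have : 0 <= M * a by [rewrite mulr_ge0 // ltW]; nra.
case/orP: hl => hl.
  have := rad_lt i0 c0 hl => h.
  apply: (@le_trans _ _ (rad M c * q)); last by rewrite ler_wpM2l ?rad_ge0 // lerDr ltW.
  by rewrite [X in X * _]mulrC; apply: key; rewrite ?rad_ge0.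
have := rad_lt j0 c0 hl => h.
apply: (@le_trans _ _ (rad M c * p)); last by rewrite ler_wpM2l ?rad_ge0 // lerDl ltW.
by apply: key; rewrite ?rad_ge0.
Qed.

Definition drawing (i : 'I_n) : 'rV[R]_2 := pt M i.
Definition graph : rel 'I_n := fun i j => edge i j.

Lemma drawing_inj : injective drawing.
Proof. by move=> i j /pt_inj; apply: val_inj. Qed.

Lemma plane_graph : plane_straight_line_graph drawing graph.
Proof.
split.
- exact: drawing_inj.
- by move=> i j; rewrite /graph edgeC.
- by move=> i; rewrite /graph /edge eqxx.
- by move=> i j k e /(edge_vertex e)[] h; [left|right]; apply: val_inj.
move=> i j k l e1 e2 ne x s1 s2.
have [||v hv xE] := edge_cross e1 e2 _ _ s1 s2.
- by move=> [/val_inj ? /val_inj ?]; subst.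
- by move=> [/val_inj ? /val_inj ?]; subst; apply: ne; rewrite finset.setUC.
(* The common point is a vertex; lying on both edges, it is an end of both by [edge_vertex]. *)
rewrite xE in s1 s2.
have [w wv] : exists w : 'I_n, val w = v.
  by move: hv; rewrite !inE => /or4P[] /eqP->; [exists i|exists j|exists k|exists l].
exists w; last by rewrite xE -wv.
rewrite !inE -!val_eqE /= wv.
apply/andP; split; [case: (edge_vertex e1 s1)|case: (edge_vertex e2 s2)] => ->;
  by rewrite eqxx ?orbT.
Qed.

Lemma triangulation_graph : triangulation drawing graph.
Proof.
split; first exact: plane_graph.
move=> e' [_ sym irr _ cross] sub i j.
wlog ij : i j / (i < j)%N => [th e|].
  case: (ltngtP i j) => [h|h|/val_inj h]; first exact: th.
    by rewrite /graph edgeC; apply: th; rewrite // sym.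
  by rewrite h irr in e.
move=> e; rewrite /graph /edge (ltn_eqF ij) /=.
have [//|i0] := posnP i; apply/or3P.
rewrite (gtn_eqF (leq_ltn_trans (leq0n i) ij)).
case vij: (vis i j); first by apply: Or33; rewrite /adj vij.
(* A further edge would meet the apex edge to the blocking vertex [c], with which it shares no
   end. *)
have [c /andP[ic cj] hl] := vis_blocked i0 ij (negbT vij).
have cn := ltn_trans cj (ltn_ord j).
have [|x [s1 s2]] := chord_meets_ray i0 _ (ltn_ord j) hl; first by rewrite ic.
have n0 : (0 < n)%N := leq_ltn_trans (leq0n _) cn.
have ec : e' (Ordinal n0) (Ordinal cn).
  by apply: sub; rewrite /graph /edge /= andbT eq_sym -lt0n (ltn_trans i0).
have [|v] := cross _ _ _ _ e ec _ x s1 s2.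
  move=> /setP/(_ i); rewrite !inE eqxx /= -!val_eqE /= (gtn_eqF i0) (ltn_eqF ic) //.
rewrite !inE -!val_eqE /= => /andP[/orP[] /eqP -> /orP[]].
- by rewrite (gtn_eqF i0).
- by rewrite (ltn_eqF ic).
- by rewrite (gtn_eqF (leq_ltn_trans (leq0n i) ij)).
- by rewrite (gtn_eqF cj).
Qed.

(** The vertices 0, 1 and 2 lie at [(0, 0)], [(1, 1)] and [(2 M, M)]. *)
Lemma drawing_not_collinear : (2 < n)%N -> ~ all_collinear drawing.
Proof.
move=> n2 [a [d [_ h]]].
have [t0 e0] := h (Ordinal (ltnW (ltnW n2))).
have [t1 e1] := h (Ordinal (ltnW n2)).
have [t2 e2] := h (Ordinal n2).
have c0 (k : 'I_2) := congr1 (fun m : 'rV[R]_2 => m 0 k) e0.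
have c1 (k : 'I_2) := congr1 (fun m : 'rV[R]_2 => m 0 k) e1.
have c2 (k : 'I_2) := congr1 (fun m : 'rV[R]_2 => m 0 k) e2.
have l1 : lev 1 = 0%N by []. have l2 : lev 2 = 1%N by [].
move: (c0 0) (c0 1) (c1 0) (c1 1) (c2 0) (c2 1); rewrite !mxE /rad /= l1 l2 expr0 expr1.
move: (a 0 0) (a 0 1) (d 0 0) (d 0 1) => a0 a1 d0 d1 h1 h2 h3 h4 h5 h6.
clear -M1 h1 h2 h3 h4 h5 h6.
have hM : 2 * M = M :> R by nra.
suff: M <= 1 by rewrite leNgt M1.
lra.
Qed.

End Bound.
End Geometry.

(** * Monotone paths *)

Section Decomposition.
Variables (R : realType) (n K : nat) (f : nat -> R) (t0 : nat).
Hypotheses (nK : (n <= 2 ^ K)%N) (f0 : f 0%N = 0).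
Hypothesis f_lev : forall x y, x \in verts n -> y \in verts n ->
  x != t0 -> y != t0 -> `|f x| < `|f y| -> (lev x <= lev y)%N.

(** Here [f] stands for the projection to a direction, and [t0] for the one vertex whose size may
    disagree with its level. *)
Let climbing x y := adj x y && (`|f x| < `|f y|).

Lemma climbing_asc p : all (mem (verts n)) p -> t0 \notin p -> sorted climbing p ->
  asc n p.
Proof.
move=> vp tp sp; rewrite /asc vp /=.
apply: (@sub_in_sorted _ [pred x | (x \in verts n) && (x != t0)]) sp.
  move=> x y; rewrite !inE => /andP[vx xt] /andP[vy yt] /andP[axy fxy].
  rewrite axy /= ltn_neqAle f_lev // andbT adj_lev //.
    by move: vx; rewrite mem_verts => /andP[].
  by move: vy; rewrite mem_verts => /andP[].
apply/allP => x xp; have /= xv := allP vp x xp; rewrite /= xv /=.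
by apply: contraNneq tp => <-.
Qed.

(** Cut at [t0], which occurs at most once since [|f|] increases. The levels of its two neighbours
    on the path compare because [|f|] increases through [t0]. *)
Lemma climbing_inserted p : all (mem (verts n)) p -> sorted climbing p ->
  p \in inserted n K.
Proof.
move=> vp sp; have [tp|tp] := boolP (t0 \in p); last first.
  by have := mem_ascents nK (climbing_asc vp tp sp); rewrite !inE !mem_cat => /orP[->|->]; rewrite ?orbT.
have up : uniq p.
  apply: (@sorted_uniq _ (fun x y => `|f x| < `|f y|)).
  - by move=> y x z; apply: lt_trans.
  - by move=> x; rewrite ltxx.
  - by apply: sub_sorted sp => x y /andP[].
case/splitPr: tp vp sp up => p1 p2; rewrite all_cat /= => /and3P[v1 vt v2] sp.
rewrite cat_uniq /= negb_or -!andbA => /and5P[_ t1 _ t2 _].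
have [s1 s2] := cat_sorted2 sp; have s2' := path_sorted s2.
have h1 : (p1 == [::]) || climbing (last 0 p1) t0.
  by case: p1 sp {v1 t1 s1} => //= x p1; rewrite cat_path => /and3P[].
have h2 : (p2 == [::]) || climbing t0 (head 0 p2).
  by case: p2 s2 {v2 t2 s2' sp} => //= x p2 /andP[].
have hv1 : (p1 == [::]) || (last 0 p1 \in verts n) && (last 0 p1 != t0).
  case: p1 v1 t1 {s1 sp h1} => //= x p1 v1 t1; have := mem_last x p1.
  move=> h; have /= -> := @allP _ (mem (verts n)) (x :: p1) v1 _ h.
  by apply: contraNneq t1 => <-.
have hv2 : (p2 == [::]) || (head 0 p2 \in verts n) && (head 0 p2 != t0).
  case: p2 v2 t2 {s2 s2' sp h2} => //= x p2 /andP[-> _].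
  by rewrite inE negb_or eq_sym => /andP[->].
apply: mem_inserted => //.
- exact: climbing_asc.
- exact: climbing_asc.
- by case/orP: h1 => [->//|/andP[-> _]]; rewrite orbT.
- by case/orP: h2 => [->//|/andP[-> _]]; rewrite orbT.
- case/orP: h1 => [->//|/andP[_ l1]]; case/orP: h2 => [->|/andP[_ l2]]; first by rewrite orbT.
  case/orP: hv1 => [->//|/andP[? ?]]; case/orP: hv2 => [->|/andP[? ?]]; first by rewrite orbT.
  by rewrite f_lev ?orbT // (lt_trans l1).
Qed.

Lemma sorted_split s : sorted (fun x y => f x < f y) s ->
  s = [seq x <- s | f x < 0] ++ [seq x <- s | 0 <= f x].
Proof.
elim: s => //= x s IH ps; have := IH (path_sorted ps).
have [fx|fx] := ltP (f x) 0; first by rewrite /= => <-.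
have all_ge0 : {in s, forall y, 0 <= f y}.
  have tr : transitive (fun x y : nat => f x < f y) by move=> ? ? ?; apply: lt_trans.
  by move=> y /(allP (order_path_min tr ps)) /ltW; apply: le_trans.
rewrite (eq_in_filter (a2 := pred0)) ?filter_pred0 => [_|y /all_ge0]; last by rewrite leNgt => /negbTE.
by rewrite (eq_in_filter (a2 := predT)) ?filter_predT.
Qed.

Lemma edge_climbing s : all (fun x => 0 < x < n)%N s -> sorted edge s ->
  sorted (fun x y => `|f x| < `|f y|) s -> all (mem (verts n)) s /\ sorted climbing s.
Proof.
move=> vs es fs; have v : all (mem (verts n)) s.
  by apply/allP => x /(allP vs); rewrite /= mem_verts.
split=> //; rewrite /climbing (sorted_relI adj (fun x y => `|f x| < `|f y|)) fs andbT.
apply: (@sub_in_sorted _ (fun x => 0 < x < n)%N) es => // x y; rewrite /in_mem /= /edge => /andP[x0 _] /andP[y0 _].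
by rewrite (gtn_eqF x0) (gtn_eqF y0) => /andP[].
Qed.

Lemma mem_candidates s : all (fun x => x < n)%N s -> sorted edge s ->
  sorted (fun x y => f x < f y) s -> s \in candidates n K.
Proof.
move=> vs es fs; have sE := sorted_split fs.
have us : uniq s.
  apply: sorted_uniq fs; first by move=> ? ? ?; apply: lt_trans.
  by move=> x; rewrite ltxx.
move: (mem_filter (fun x => f x < 0)) (mem_filter (fun x => 0 <= f x)) => mL mR.
set l := [seq x <- s | f x < 0] in sE; set r := [seq x <- s | 0 <= f x] in sE.
have {mL} ml x : x \in l -> f x < 0 /\ x \in s by rewrite mL => /andP[].
have {mR} mr x : x \in r -> 0 <= f x /\ x \in s by rewrite mR => /andP[].
clearbody l r.
have /cat_sorted2[sl sr] : sorted edge (l ++ r) by rewrite -sE.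
have /cat_sorted2[fl fr] : sorted (fun x y => f x < f y) (l ++ r) by rewrite -sE.
have [vl cl] : all (mem (verts n)) (rev l) /\ sorted climbing (rev l).
  apply: edge_climbing.
  - rewrite all_rev; apply/allP => x /ml[fx /(allP vs) ->]; rewrite andbT lt0n.
    by apply: contraTneq fx => ->; rewrite f0 ltxx.
  - by rewrite rev_sorted; apply: sub_sorted sl => x y; rewrite edgeC.
  - rewrite rev_sorted; apply: (@sub_in_sorted _ (fun x => f x < 0)) fl.
      by move=> x y; rewrite /in_mem /= => fx fy fxy; rewrite !ltr0_norm // ltrN2.
    by apply/allP => x /ml[].
(* The apex has value 0, so it can only come first among the nonnegative values. *)
have [z [q [hz rE nz]]] : exists z q, [/\ z \in [:: [::]; [:: 0%N]], r = z ++ q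
    & 0%N \notin q].
  have [r0|r0] := boolP (0%N \in r); last by exists [::], r.
  have tr : transitive (fun x y : nat => f x < f y) by move=> ? ? ?; apply: lt_trans.
  case: r mr {sE sr} fr r0 => // x q mr fq.
  have hq := order_path_min tr fq.
  have nq : 0%N \notin q.
    apply/negP => /(allP hq); rewrite f0; apply/negP; rewrite -leNgt.
    by have [] := mr x (mem_head _ _).
  by rewrite inE (negbTE nq) orbF => /eqP <-; exists [:: 0%N], q.
have mq x : x \in q -> 0 <= f x /\ x \in s by move=> xq; apply: mr; rewrite rE mem_cat xq orbT.
rewrite rE in sr fr; have [_ sq] := cat_sorted2 sr; have [_ fq] := cat_sorted2 fr.
have [vq cq] : all (mem (verts n)) q /\ sorted climbing q.
  apply: edge_climbing => //.
    apply/allP => x xq; have [_ /(allP vs) ->] := mq x xq; rewrite andbT lt0n.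
    by apply: contraNneq nz => <-.
  apply: (@sub_in_sorted _ (fun x => 0 <= f x)) fq.
    by move=> x y; rewrite /in_mem /= => fx fy fxy; rewrite !ger0_norm.
  by apply/allP => x /mq[].
(* The path is simple, so one half avoids [t0] and is purely ascending. *)
have tlq : (t0 \notin rev l) || (t0 \notin q).
  rewrite -negb_and mem_rev; apply/negP => /andP[tl tq].
  move: us; rewrite sE rE !cat_uniq => /and3P[_ /hasPn/(_ t0) h _].
  by move: h; rewrite mem_cat tq orbT => /(_ isT); rewrite /= tl.
rewrite mem_cat sE rE -{1 2}(revK l); case/orP: tlq => h; apply/orP; [left|right];
  apply: mem_joins => //; try exact: climbing_inserted; exact/mem_ascents/climbing_asc.
Qed.

End Decomposition.

(** * Sizes of projections and the count over all directions *)

Section Directions.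
Variables (R : realType) (n : nat).
Let M : R := (2 * n + 2)%:R.

(* For [u1 != 0], [t0] is the integer at distance less than [1/2] from [- u2 / u1], if any. *)
Lemma exceptional_vertex (u1 u2 : R) : exists t0 : nat, forall x y : nat,
  (x < n)%N -> (y < n)%N -> x != t0 -> y != t0 ->
  `|x%:R * u1 + u2| <= M * `|y%:R * u1 + u2|.
Proof.
have [t0 h] : exists t0 : nat, forall y : nat, y != t0 -> `|u1| <= 2 * `|y%:R * u1 + u2|.
  have [[t ht]|h] := pselect (exists t : nat, 2 * `|t%:R * u1 + u2| < `|u1|).
    exists t => y yt; rewrite leNgt; apply/negP => hy.
    (* Two integers this close to the root would be at distance less than 1. *)
    have : `|(y%:R - t%:R) * u1| < `|u1|.
      have -> : (y%:R - t%:R) * u1 = (y%:R * u1 + u2) - (t%:R * u1 + u2) by ring.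
      by apply: le_lt_trans (ler_normB _ _) _; lra.
    rewrite normrM ltNge => /negP; apply; rewrite -[leLHS]mul1r ler_wpM2r //.
    have [l|l|e] := ltngtP y t; last by rewrite e eqxx in yt.
      by rewrite distrC -natrB ?(ltnW l) // normr_nat ler1n subn_gt0.
    by rewrite -natrB ?(ltnW l) // normr_nat ler1n subn_gt0.
  by exists 0%N => y _; rewrite leNgt; apply/negP => hy; apply: h; exists y.
exists t0 => x y xn yn _ /h hy.
(* The triangle inequality gives the factor [2 n + 1], which is less than [M]. *)
have -> : x%:R * u1 + u2 = (x%:R - y%:R) * u1 + (y%:R * u1 + u2) by ring.
apply: le_trans (ler_normD _ _) _; rewrite normrM.
have hxy : `|x%:R - y%:R : R| <= n%:R.
  rewrite ler_norml; have xn' : x%:R <= n%:R :> R by rewrite ler_nat ltnW.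
  have yn' : y%:R <= n%:R :> R by rewrite ler_nat ltnW.
  have := ler0n R x; have := ler0n R y; lra.
have : `|x%:R - y%:R : R| * `|u1| <= n%:R * (2 * `|y%:R * u1 + u2|) by apply: ler_pM.
have := normr_ge0 (y%:R * u1 + u2).
rewrite /M natrD natrM; move: (`|_ * u1 + u2|) => a; nra.
Qed.

(** If [y] is lower than [x], the radius of [x] gains a factor [M], which makes up for the loss of
    at most [M] in the affine factor. *)
Lemma projection_lev (u : 'rV[R]_2) : exists t0 : nat, forall x y : nat,
  x \in verts n -> y \in verts n -> x != t0 -> y != t0 ->
  `|dot (pt M x) u| < `|dot (pt M y) u| -> (lev x <= lev y)%N.
Proof.
have [t0 h] := exceptional_vertex (u 0 0) (u 0 1); exists t0 => x y.
rewrite !mem_verts => /andP[x0 xn] /andP[y0 yn] xt yt.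
have M1 : 1 < M by rewrite ltr1n addn2.
apply: contraTT; rewrite -ltnNge => l; rewrite -leNgt.
rewrite !dot_pt !normrM !(ger0_norm (rad_ge0 M1 _)).
have h1 := h _ _ yn xn yt xt; have h2 := rad_lt M1 y0 x0 l; have h3 := rad_ge0 M1 y.
apply: (@le_trans _ _ (rad M y * (M * `|x%:R * u 0 0 + u 0 1|))).
  by rewrite ler_wpM2l.
by rewrite mulrA [X in X * _]mulrC ler_wpM2r.
Qed.

(** The exceptional vertex varies with the direction but [candidates] does not, so this one list
    serves all directions. *)
Lemma num_monotone_paths_le (K : nat) : (n <= 2 ^ K)%N -> (0 < K)%N ->
  (num_monotone_paths (@drawing R M n) (@graph n) <= 80 * K ^ 2 * 9 ^ K)%N.
Proof.
move=> nK K0; apply: leq_trans (size_candidates nK K0).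
rewrite /num_monotone_paths cardE -(size_map (fun w : n.-bseq 'I_n => map val w)).
apply: uniq_leq_size.
  rewrite map_inj_uniq ?enum_uniq // => v w /(inj_map val_inj); exact: val_inj.
move=> _ /mapP[w + ->]; rewrite mem_enum inE => /asboolP[[_ _ ew] [u _ mw]].
have [t0 h] := projection_lev u.
apply: (mem_candidates (f := fun x => dot (pt M x) u) (t0 := t0)) => //.
- by rewrite dot_pt rad0 mul0r.
- by apply/allP => x /mapP[i _ ->] /=; apply: ltn_ord.
- by rewrite sorted_map.
- rewrite sorted_map; apply: sub_sorted mw => i j /=.
  have -> : dot (drawing M j - drawing M i) u = dot (pt M j) u - dot (pt M i) u.
    by rewrite !dotE !mxE; ring.
  by rewrite subr_gt0.
Qed.

End Directions.

(** * Asymptotics *)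

Section Growth.
Variable R : realType.

Lemma ln2_gt0 : 0 < ln 2 :> R.
Proof. by rewrite ln_gt0 // ltr1n. Qed.

Lemma ln_ratio_lt (a b c d : nat) : (0 < a)%N -> (0 < c)%N -> (a ^ b < c ^ d)%N ->
  b%:R * ln a%:R < d%:R * ln c%:R :> R.
Proof.
move=> a0 c0; rewrite -(ltr_nat R) !natrX => h.
by rewrite !mulr_natl -!lnXn ?ltr0n // ltr_ln // posrE exprn_gt0 ?ltr0n.
Qed.

Lemma two_log2_3_lt : 2 * log2 3 < 317 / 100 :> R.
Proof.
(* This says [log2 3 < 317 / 200]. *)
have h : (3 ^ 200 < 2 ^ 317)%N by lia.
have {}h := @ln_ratio_lt 3 200 2 317 isT isT h.
rewrite /log2 mulrA ltr_pdivrMr ?ln2_gt0 //.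
move: (ln 2) (ln 3) h => x y h; lra.
Qed.

(** [9 ^ k] is [2 ^ k] raised to the power [2 * log2 3]. *)
Lemma pow9_le (k n : nat) : (2 ^ k <= n)%N ->
  9 ^+ k <= (n%:R : R) `^ (2 * log2 3) /\ k%:R <= log2 (n%:R : R).
Proof.
move=> kn; have n0 : (0 < n)%N by apply: leq_trans kn; rewrite expn_gt0.
have hk : k%:R * ln 2 <= ln n%:R :> R.
  by rewrite mulrC mulr_natr -lnXn // -natrX ler_ln ?posrE ?ltr0n ?expn_gt0 // ler_nat.
split; last by rewrite /log2 ler_pdivlMr ?ln2_gt0.
have h3 : 0 <= ln 3 :> R by rewrite ln_ge0 // ler1n.
rewrite /powR pnatr_eq0 (gtn_eqF n0).
have -> : 9 ^+ k = expR (ln (9 ^+ k)) :> R by rewrite lnK // posrE exprn_gt0.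
rewrite ler_expR lnXn // (_ : 9 = 3 ^+ 2) ?lnXn //; last by ring.
have -> : ln 3 *+ 2 *+ k = (2 * log2 3) * (k%:R * ln 2) :> R.
  by rewrite -(mulr_natr _ k) /log2; field; rewrite lt0r_neq0 // ln2_gt0.
by rewrite ler_wpM2l // mulr_ge0 // divr_ge0 // ltW // ln2_gt0.
Qed.

(** With [up_log 2 n = k + 1], both [k] and 1 are at most [log2 n], so [(k + 1) ^ 2] costs a factor
    4; [2880 = 80 * 9 * 4]. *)
Lemma path_bound (n : nat) : (1 < n)%N ->
  ((80 * up_log 2 n ^ 2 * 9 ^ up_log 2 n)%N)%:R <=
  2880 * (n%:R `^ (2 * log2 3) * log2 n%:R ^+ 2) :> R.
Proof.
move=> n1; have [k kE] : exists k, up_log 2 n = k.+1.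
  by exists (up_log 2 n).-1; rewrite prednK // up_log_gt0.
have kn : (2 ^ k < n)%N by case/andP: (up_log_bounds (isT : 1 < 2)%N n1); rewrite kE.
have [P L] := pow9_le (ltnW kn); have [_ L1] := @pow9_le 1 n n1.
have -> : ((80 * up_log 2 n ^ 2 * 9 ^ up_log 2 n)%N)%:R =
    80 * (k%:R + 1) ^+ 2 * (9 * 9 ^+ k) :> R.
  by rewrite kE !natrM !natrX exprS natr1.
move: (n%:R `^ (2 * log2 3)) (log2 n%:R) P L L1 => p l P L L1.
have k0 := ler0n R k; have q0 : 0 <= 9 ^+ k :> R by rewrite exprn_ge0.
move: (9 ^+ k) (k%:R) P L k0 q0 => q x P L k0 q0.
have h1 : (x + 1) ^+ 2 <= 4 * l ^+ 2 by nra.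
have h2 : (x + 1) ^+ 2 * q <= 4 * l ^+ 2 * p by rewrite ler_pM // exprn_ge0 // addr_ge0.
lra.
Qed.

(** Half of the gap [d] between the exponents absorbs each logarithm: [ln n] is [2 / d] times the
    logarithm of [n] to the power [d / 2]. *)
Lemma log_sqr_le (n : nat) : (0 < n)%N ->
  n%:R `^ (2 * log2 3) * log2 n%:R ^+ 2 <=
  (2 / (317 / 100 - 2 * log2 3) / ln 2) ^+ 2 * n%:R `^ (317 / 100) :> R.
Proof.
move=> n0; have := two_log2_3_lt; set a : R := 2 * log2 3 => ha.
pose d := 317 / 100 - a; have d0 : 0 < d by rewrite subr_gt0.
have n0' : 0 < n%:R :> R by rewrite ltr0n.
have e : n%:R `^ (317 / 100) = n%:R `^ a * (n%:R `^ (d / 2)) ^+ 2 :> R.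
  rewrite expr2 mulrA -!powRD ?(gt_eqF n0') ?implybT //.
  by congr (_ `^ _); rewrite /d; field.
have l : ln n%:R <= 2 / d * n%:R `^ (d / 2) :> R.
  have -> : ln n%:R = 2 / d * ln (n%:R `^ (d / 2)) :> R.
    by rewrite ln_powR; field; rewrite lt0r_neq0.
  by rewrite ler_wpM2l ?divr_ge0 ?(ltW d0) // ltW // ln_sublinear // powR_gt0.
have l0 : 0 <= ln n%:R :> R by rewrite ln_ge0 // ler1n.
rewrite e [leRHS]mulrCA ler_wpM2l ?powR_ge0 // -exprMn -/d lerXn2r ?nnegrE //.
- by rewrite /log2 divr_ge0 // ltW // ln2_gt0.
- by rewrite mulr_ge0 ?powR_ge0 // !divr_ge0 // ltW // ?ln2_gt0.
by rewrite /log2 mulrAC ler_wpM2r // invr_ge0 ltW // ln2_gt0.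
Qed.

End Growth.

Theorem theorem3 (R : realType) :
  exists (p : forall n : nat, 'I_n -> 'rV[R]_2) (e : forall n : nat, rel 'I_n),
    [/\ forall n : nat, triangulation (p n) (e n),
        forall n : nat, (2 < n)%N -> ~ all_collinear (p n),
        (fun n : nat => (num_monotone_paths (p n) (e n))%:R : R^o) =O_\oo
          (fun n : nat => n%:R `^ (2 * log2 3) * log2 n%:R ^+ 2 : R^o)
      & (fun n : nat => n%:R `^ (2 * log2 3) * log2 n%:R ^+ 2 : R^o) =O_\oo
          (fun n : nat => n%:R `^ (317 / 100) : R^o)].
Proof.
exists (fun n => @drawing R (2 * n + 2)%:R n), (fun n => @graph n); split.
- move=> n; apply: triangulation_graph; first by rewrite ltr1n addn2.
  by rewrite ler_nat mul2n -addnn -addnA leq_addr.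
- by move=> n n2; apply: drawing_not_collinear => //; rewrite ltr1n addn2.
- apply/eqO_exP; exists 2880; first by rewrite ltr0n.
  near=> n.
  (* At [n = 1] the logarithm vanishes although there is one path. *)
  have n1 : (1 < n)%N by near: n; apply: nbhs_infty_gt.
  rewrite normr_nat (ger0_norm (mulr_ge0 (powR_ge0 _ _) (sqr_ge0 _))).
  apply: le_trans (path_bound R n1); rewrite ler_nat.
  by apply: num_monotone_paths_le; rewrite ?up_log_gt0 ?up_logP.
- apply/eqO_exP; exists ((2 / (317 / 100 - 2 * log2 3) / ln 2) ^+ 2).
    rewrite exprn_gt0 // divr_gt0 ?ln2_gt0 // divr_gt0 // subr_gt0.
    exact: two_log2_3_lt.
  near=> n; have n0 : (0 < n)%N by near: n; apply: nbhs_infty_gt.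
  rewrite (ger0_norm (powR_ge0 _ _)) (ger0_norm (mulr_ge0 (powR_ge0 _ _) (sqr_ge0 _))).
  exact: log_sqr_le.
Unshelve. all: by end_near.
Qed.
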